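(* Let $(\mathbb F,\star)\in\{(\mathbb C,* ),(\mathbb R,\top)\}$ and let $E,Q\in\mathbb F^{m,n}$ be such that $E^\star Q=Q^\star E$ and $EQ^\star=QE^\star$. Then there exist unitary (real orthogonal if $\mathbb F=\mathbb R$) matrices $U\in\mathbb F^{m,m}$, $V\in\mathbb F^{n,n}$ such that $UEV$ and $UQV$ are diagonal and real. Furthermore, $U$ and $V$ can be chosen such that one of the matrices $UEV$ and $UQV$ is nonnegative, and if in addition $E^\star Q\ge 0$ holds, then $U,V$ can be chosen such that $UEV$ and $UQV$ are both nonnegative.
   Context: $*$ is conjugate transpose, $\top$ is transpose. A (possibly rectangular) matrix $D=[d_{ij}]$ is called diagonal if $d_{ij}=0$ whenever $i\ne j$; such a real matrix is nonnegative if all its entries are $\ge 0$. $W\ge0$ for a Hermitian (real symmetric) matrix means positive semidefinite. *)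

(* Defs.v *)
From mathcomp Require Import all_boot all_order all_algebra.
From mathcomp Require Import reals complex.

Set Implicit Arguments.
Unset Strict Implicit.
Unset Printing Implicit Defensive.

Import GRing.Theory Num.Theory.
Local Open Scope ring_scope.
Local Open Scope sesquilinear_scope.

(* A field F of scalars with the conjugation that defines the adjoint: either *)
(* the reals with the identity or the complex numbers with conjugation. The   *)
(* adjoint of A is A ^t c = map_mx c A^T.                                     *)
Variant real_or_complex (R : realType) :
    forall F : numFieldType, (F -> F) -> Prop :=
  | RealScalars : @real_or_complex R (R : numFieldType) idfun
  | ComplexScalars : @real_or_complex R (R[i] : numFieldType) Num.conj.

Definition unitary (F : numFieldType) (c : F -> F) n (U : 'M[F]_n) : Prop :=
  U *m U ^t c = 1%:M.

(* In R[i], 0 <= z means that z is real and nonnegative. *)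
Definition possemidef (F : numFieldType) (c : F -> F) n (W : 'M[F]_n) : Prop :=
  W ^t c = W /\ forall x : 'cV[F]_n, 0 <= (x ^t c *m W *m x) 0 0.

Definition diagonal_real (F : numFieldType) m n (D : 'M[F]_(m, n)) : Prop :=
  is_diag_mx D /\ D \is a mxOver Num.real.

(* Main.v *)
Require Import Defs.
From mathcomp Require Import all_boot all_order all_algebra.
From mathcomp Require Import reals complex ring.

Import Order.TTheory GRing.Theory Num.Theory.
Local Open Scope ring_scope.
Local Open Scope sesquilinear_scope.

(** The conditions on E and Q say exactly that the Hermitian dilations
      A = [0, E; E^*, 0]   and   B = [0, Q; Q^*, 0]
    commute, since AB = [EQ^*, 0; 0, E^*Q]. Commuting Hermitian matrices have a
    common eigenvector (u, v), with real eigenvalues a and b; unfolded, this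
    says
      E v = a u,  E^* u = a v,  Q v = b u,  Q^* u = b v,
    so that u and v form a singular pair of E and of Q at the same time
    ([joint_singular_pair]).

    The simultaneous diagonalization [compatible_simdiag] follows by induction
    on m + n. If u and v are both nonzero, they can be normalized separately:
    if a or b is nonzero the two norms agree, and otherwise the equations do
    not see the norms. Unitary matrices that send u and v to the first basis
    vectors turn E and Q into block_mx a 0 0 E' and block_mx b 0 0 Q', where E'
    and Q' satisfy the same hypotheses. If v = 0, then u is killed by E^* and
    Q^*, and sending u to the last basis vector splits off a zero last row,
    which does not disturb diagonality; u = 0 is the adjoint case.

    Both scalar fields are treated at once, over a field with a conjugation c
    such that x * c x = |x|^2. Only two facts depend on the field: nonnegative
    scalars have square roots, and commuting Hermitian matrices have a common
    real eigenpair. For real matrices the latter comes from a complex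
    eigenvector: the eigenvalues being real, the real part of the vector or of
    its multiple by i is a nonzero real eigenvector.

    Signs are corrected at the end. Left multiplication by a diagonal matrix of
    signs changes the sign of the i-th diagonal entries of UEV and UQV together,
    so any one of them can be made nonnegative, and both can as soon as the two
    entries have a nonnegative product. The products are the diagonal entries
    of V^* (E^* Q) V, hence nonnegative when E^* Q is positive semidefinite. *)

Set Implicit Arguments.
Unset Strict Implicit.
Unset Printing Implicit Defensive.

(** * Unitary matrices over a field with a conjugation *)

Section Conjugation.

Variables (F : numFieldType) (c : {rmorphism F -> F}).
Hypothesis cK : involutive c.

Local Notation "A ^H" := (map_mx c (trmx A)) (at level 8, format "A ^H").

Lemma adjK m n (A : 'M[F]_(m, n)) : A^H^H = A.
Proof. by apply/matrixP => i j; rewrite !mxE cK. Qed.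

Lemma adjM m n p (A : 'M[F]_(m, n)) (B : 'M_(n, p)) : (A *m B)^H = B^H *m A^H.
Proof. by rewrite trmx_mul map_mxM. Qed.

Lemma adjZ m n a (A : 'M[F]_(m, n)) : (a *: A)^H = c a *: A^H.
Proof. by rewrite linearZ map_mxZ. Qed.

Lemma adjB m n (A B : 'M[F]_(m, n)) : (A - B)^H = A^H - B^H.
Proof. by rewrite linearB map_mxB. Qed.

Lemma adj1 n : (1%:M : 'M[F]_n)^H = 1%:M.
Proof. by rewrite trmx1 map_mx1. Qed.

Lemma adj0 m n : (0 : 'M[F]_(m, n))^H = 0.
Proof. by rewrite trmx0 map_mx0. Qed.

Lemma adj_inj m n (A B : 'M[F]_(m, n)) : A^H = B^H -> A = B.
Proof. by move=> AB; rewrite -(adjK A) AB adjK. Qed.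

Lemma adj_block m1 m2 n1 n2 (A : 'M[F]_(m1, n1)) (B : 'M_(m1, n2))
    (C : 'M_(m2, n1)) (D : 'M_(m2, n2)) :
  (block_mx A B C D)^H = block_mx A^H C^H B^H D^H.
Proof. by rewrite tr_block_mx map_block_mx. Qed.

Lemma adj_col m1 m2 n (A : 'M[F]_(m1, n)) (B : 'M_(m2, n)) :
  (col_mx A B)^H = row_mx A^H B^H.
Proof. by rewrite tr_col_mx map_row_mx. Qed.

Lemma unitary_adj n (U : 'M[F]_n) : unitary c U -> U^H *m U = 1%:M.
Proof. exact: mulmx1C. Qed.

Lemma unitaryH n (U : 'M[F]_n) : unitary c U -> unitary c U^H.
Proof. by move=> /unitary_adj UU; rewrite /unitary adjK. Qed.

Lemma unitary1 n : unitary c (1%:M : 'M[F]_n).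
Proof. by rewrite /unitary adj1 mulmx1. Qed.

Lemma unitaryM n (U V : 'M[F]_n) :
  unitary c U -> unitary c V -> unitary c (U *m V).
Proof.
by move=> UU VV; rewrite /unitary adjM mulmxA -(mulmxA U) VV mulmx1.
Qed.

Lemma unitary_block m n (U : 'M[F]_m) (V : 'M[F]_n) :
  unitary c U -> unitary c V -> unitary c (block_mx U 0 0 V).
Proof.
move=> UU VV; rewrite /unitary adj_block !adj0 mulmx_block.
by rewrite !mulmx0 !mul0mx !addr0 !add0r UU VV -scalar_mx_block.
Qed.

Hypothesis mul_conj : forall x, x * c x = `|x| ^+ 2.

Lemma conj_real a : a \is Num.real -> c a = a.
Proof.
move=> ar; have [->|a0] := eqVneq a 0; first by rewrite rmorph0.
by apply: (mulfI a0); rewrite mul_conj real_normK.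
Qed.

Lemma sqnormE n (u : 'cV[F]_n) : (u^H *m u) 0 0 = \sum_i `|u i 0| ^+ 2.
Proof.
by rewrite mxE; apply: eq_bigr => i _; rewrite !mxE mulrC mul_conj.
Qed.

Lemma sqnorm_ge0 n (u : 'cV[F]_n) : 0 <= (u^H *m u) 0 0.
Proof. by rewrite sqnormE sumr_ge0 // => i _; rewrite exprn_ge0. Qed.

Lemma sqnorm_eq0 n (u : 'cV[F]_n) : ((u^H *m u) 0 0 == 0) = (u == 0).
Proof.
rewrite sqnormE; apply/eqP/eqP => [s0|->]; last first.
  by rewrite big1 // => i _; rewrite mxE normr0 expr0n.
apply/matrixP => i j; rewrite ord1 mxE.
have sq_ge0 k : true -> 0 <= `|u k 0| ^+ 2 by rewrite exprn_ge0.
have /(_ i isT)/eqP := psumr_eq0P sq_ge0 s0.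
by rewrite expf_eq0 normr_eq0 => /eqP.
Qed.

(** A reflection can exchange two unit vectors only if their inner product is
    real; multiplying one of them by this scalar of modulus 1 makes it so. *)
Lemma phase_correction z : exists2 zeta, zeta * c zeta = 1 & zeta * z = `|z|.
Proof.
have [->|z0] := eqVneq z 0.
  by exists 1; rewrite ?rmorph1 ?mulr1 // mulr0 normr0.
have n0 : `|z| != 0 by rewrite normr_eq0.
exists (c z / `|z|).
  rewrite rmorphM fmorphV /= cK (conj_real (normr_real z)).
  by rewrite mulrACA (mulrC (c z)) mul_conj -invfM -expr2 divff // expf_neq0.
by rewrite mulrAC (mulrC (c z)) mul_conj expr2 mulfK.
Qed.

(** After a phase correction making the inner product e^* u' real, the
    Householder reflection along w = u' - e exchanges u' and e. *)
Lemma unitary_transport n (u e : 'cV[F]_n) :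
  u^H *m u = 1%:M -> e^H *m e = 1%:M -> exists2 U, unitary c U & U *m u = e.
Proof.
move=> u1 e1.
have [zeta zz zr] := phase_correction ((e^H *m u) 0 0).
set r := `|_| in zr.
pose u' := zeta *: u; pose w := u' - e; pose q := (w^H *m w) 0 0.
have eu' : e^H *m u' = r%:M.
  by rewrite -scalemxAr [e^H *m u]mx11_scalar scale_scalar_mx zr.
have u'e : u'^H *m e = r%:M.
  apply: adj_inj; rewrite adjM adjK eu' tr_scalar_mx map_scalar_mx.
  by rewrite conj_real ?normr_real.
have u'1 : u'^H *m u' = 1%:M.
  by rewrite adjZ -scalemxAl -scalemxAr scalerA u1 mulrC zz scale1r.
(* For u' = e there is nothing to reflect, only the phase to correct. *)
have [w0|wN0] := eqVneq w 0.
  exists zeta%:M.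
    by rewrite /unitary tr_scalar_mx map_scalar_mx -scalar_mxM zz.
  by rewrite mul_scalar_mx; apply/subr0_eq.
have wu' : w^H *m u' = (1 - r)%:M by rewrite adjB mulmxBl u'1 eu' -raddfB.
have ww : w^H *m w = q%:M by rewrite [LHS]mx11_scalar.
have q0 : q != 0 by rewrite /q sqnorm_eq0.
(* Since |w|^2 = q = 2 w^* u', the reflection I - (2/q) w w^* subtracts exactly
   w from u'. *)
have qE : q = 2 * (1 - r).
  rewrite /q {2}/w mulmxBr wu' adjB mulmxBl u'e e1 !mxE eqxx !mulr1n; ring.
pose k := 2 / q; pose H := 1%:M - k *: (w *m w^H).
have ck : c k = k.
  by rewrite conj_real // rpredM ?rpredV ?realn // ger0_real // sqnorm_ge0.
have HH : H^H = H by rewrite adjB adj1 adjZ ck adjM adjK.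
exists (zeta *: H).
  rewrite /unitary adjZ -scalemxAl -scalemxAr scalerA zz scale1r HH.
  rewrite mulmxBl mul1mx mulmxBr mulmx1 -scalemxAl -scalemxAr.
  rewrite mulmxA -(mulmxA w) ww mul_mx_scalar -scalemxAl !scalerA.
  have -> : k * (k * q) = k + k by rewrite /k; field.
  by rewrite scalerDl opprB addrK /H subrK.
rewrite -scalemxAl scalemxAr -/u' mulmxBl mul1mx -scalemxAl -mulmxA wu'.
rewrite mul_mx_scalar scalerA.
have -> : k * (1 - r) = 1.
  apply: (mulfI q0); rewrite mulrA /k mulrCA divff // !mulr1 qE; ring.
by rewrite scale1r /w opprB addrC subrK.
Qed.

Hypothesis sqrtF : forall x : F, 0 <= x -> exists2 y, 0 <= y & y ^+ 2 = x.

Lemma cV_neq0_size n (u : 'cV[F]_n) :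
  u != 0 -> exists n', n = n'.+1.
Proof.
by case: n u => [|n] u; [rewrite flatmx0 eqxx|exists n].
Qed.

(** The norm s is exposed because the norms of two vectors will be compared. *)
Lemma normalize_col n (u : 'cV[F]_n) :
  u != 0 ->
  exists s, [/\ 0 < s, u^H *m u = (s ^+ 2)%:M
              & (s^-1 *: u)^H *m (s^-1 *: u) = 1%:M].
Proof.
move=> u0; have [s s_ge0 s2] := sqrtF (sqnorm_ge0 u).
have s0 : s != 0.
  by apply: contraNneq u0 => s0; rewrite -sqnorm_eq0 -s2 s0 expr0n.
exists s; split; first by rewrite lt0r s0.
  by rewrite s2 -mx11_scalar.
rewrite adjZ -scalemxAl -scalemxAr scalerA conj_real ?rpredV ?ger0_real //.
rewrite [u^H *m u]mx11_scalar -s2 scale_scalar_mx -expr2 -exprMn mulVf //.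
by rewrite expr1n.
Qed.

Lemma hermitian_eigenvalue_conj n (A : 'M[F]_n) (x : 'rV_n) a :
  A^H = A -> x != 0 -> x *m A = a *: x -> c a = a.
Proof.
move=> AH x0 xA; pose u := x^H.
have u0 : (x *m u) 0 0 != 0.
  rewrite -{1}[x]adjK sqnorm_eq0; apply: contra_neq x0 => u0.
  by apply: adj_inj; rewrite adj0.
have : (x *m A *m u)^H = x *m A *m u by rewrite !adjM AH adjK mulmxA.
rewrite xA -scalemxAl adjZ adjM [u^H]adjK.
by move=> /matrixP/(_ 0 0); rewrite mxE [RHS]mxE => /(mulIf u0).
Qed.

(** * Simultaneous diagonalization *)

Definition compatible m n (E Q : 'M[F]_(m, n)) : Prop :=
  E^H *m Q = Q^H *m E /\ E *m Q^H = Q *m E^H.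

Definition simdiag m n (E Q : 'M[F]_(m, n)) : Prop :=
  exists (U : 'M[F]_m) (V : 'M[F]_n),
    [/\ unitary c U, unitary c V,
        diagonal_real (U *m E *m V) & diagonal_real (U *m Q *m V)].

Definition singular_pair m n (E : 'M[F]_(m, n)) a (u : 'cV_m) (v : 'cV_n) :=
  E *m v = a *: u /\ E^H *m u = a *: v.

Lemma compatible_adj m n (E Q : 'M[F]_(m, n)) :
  compatible E Q -> compatible E^H Q^H.
Proof. by case=> EQ QE; split; rewrite !adjK. Qed.

Lemma compatible_equiv m n (U : 'M[F]_m) (V : 'M[F]_n) E Q :
  unitary c U -> unitary c V -> compatible E Q ->
  compatible (U *m E *m V) (U *m Q *m V).
Proof.
move=> UU VV [EQ QE]; have U'U := unitary_adj UU.
have left_cancel A B :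
    (U *m A *m V)^H *m (U *m B *m V) = V^H *m (A^H *m B) *m V.
  by rewrite !adjM !mulmxA -(mulmxA _ U^H U) U'U mulmx1.
have right_cancel A B :
    (U *m A *m V) *m (U *m B *m V)^H = U *m (A *m B^H) *m U^H.
  by rewrite !adjM !mulmxA -(mulmxA _ V V^H) VV mulmx1.
by split; rewrite ?left_cancel ?right_cancel ?EQ ?QE.
Qed.

(** Compatibility survives deflation, because all products involved are block
    diagonal. *)
Lemma compatible_block m1 m2 n1 n2 (E1 Q1 : 'M[F]_(m1, n1))
    (E2 Q2 : 'M[F]_(m2, n2)) :
  compatible (block_mx E1 0 0 E2) (block_mx Q1 0 0 Q2) -> compatible E2 Q2.
Proof.
rewrite /compatible !adj_block !adj0 !mulmx_block.
rewrite !mulmx0 !mul0mx !addr0 !add0r.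
by case=> /eq_block_mx[_ _ _ EQ] /eq_block_mx[_ _ _ QE].
Qed.

Lemma compatible_col m1 m2 n (E Q : 'M[F]_(m1, n)) :
  compatible (col_mx E (0 : 'M_(m2, n))) (col_mx Q 0) -> compatible E Q.
Proof.
rewrite /compatible !adj_col !adj0 !mul_row_col !mul_col_row.
rewrite !mulmx0 !mul0mx !addr0.
by case=> EQ /eq_block_mx[QE _ _ _].
Qed.

Lemma diagonal_real_adj m n (D : 'M[F]_(m, n)) :
  diagonal_real D -> diagonal_real D^H.
Proof.
case=> /is_diag_mxP Dd /mxOverP Dr; split.
  by apply/is_diag_mxP => i j ij; rewrite !mxE Dd ?rmorph0 // eq_sym.
by apply/mxOverP => i j; rewrite !mxE conj_real.
Qed.

Lemma simdiag_adj m n (E Q : 'M[F]_(m, n)) : simdiag E^H Q^H -> simdiag E Q.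
Proof.
case=> U [V] [UU VV DE DQ]; exists V^H, U^H.
split; try exact: unitaryH.
  by move: (diagonal_real_adj DE); rewrite !adjM adjK mulmxA.
by move: (diagonal_real_adj DQ); rewrite !adjM adjK mulmxA.
Qed.

Lemma simdiag_equiv m n (U : 'M[F]_m) (V : 'M[F]_n) E Q :
  unitary c U -> unitary c V ->
  simdiag (U *m E *m V) (U *m Q *m V) -> simdiag E Q.
Proof.
move=> UU VV [U' [V' [UU' VV' DE DQ]]]; exists (U' *m U), (V *m V').
by split; try exact: unitaryM; rewrite !mulmxA in DE DQ *.
Qed.

Lemma diagonal_real_block m n a (D : 'M[F]_(m, n)) :
  a \is Num.real -> diagonal_real D ->
  diagonal_real (block_mx (a%:M : 'M_1) 0 0 D).
Proof.
move=> ar [Dd /mxOverP Dr]; split.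
  by rewrite is_diag_block_mx // !eqxx Dd scalar_mx_is_diag.
apply/mxOverP => i j; rewrite !mxE.
by case: splitP => i' _; rewrite ?mxE; case: splitP => j' _;
  rewrite ?mxE ?ord1 ?eqxx ?real0.
Qed.

(** The zero row has to come last: a first zero row would shift the
    diagonal of D. *)
Lemma diagonal_real_col m n (D : 'M[F]_(m, n)) :
  diagonal_real D -> diagonal_real (col_mx D (0 : 'rV_n)).
Proof.
case=> [/is_diag_mxP Dd /mxOverP Dr]; split.
  apply/is_diag_mxP => i j ij; rewrite mxE.
  by case: splitP ij => i' ->; rewrite ?mxE // => /Dd.
by apply/mxOverP => i j; rewrite !mxE; case: splitP => i' _; rewrite ?mxE.
Qed.

Lemma simdiag_block m n (E Q : 'M[F]_(m, n)) a b :
  a \is Num.real -> b \is Num.real -> simdiag E Q ->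
  simdiag (block_mx (a%:M : 'M_1) 0 0 E) (block_mx (b%:M : 'M_1) 0 0 Q).
Proof.
move=> ar br [U [V [UU VV DE DQ]]].
exists (block_mx 1%:M 0 0 U), (block_mx 1%:M 0 0 V).
split; try by apply: unitary_block => //; exact: unitary1.
  rewrite !mulmx_block !(mulmx0, mul0mx, addr0, add0r, mulmx1, mul1mx).
  exact: diagonal_real_block.
rewrite !mulmx_block !(mulmx0, mul0mx, addr0, add0r, mulmx1, mul1mx).
exact: diagonal_real_block.
Qed.

Lemma simdiag_col m n (E Q : 'M[F]_(m, n)) :
  simdiag E Q -> simdiag (col_mx E (0 : 'rV_n)) (col_mx Q 0).
Proof.
move=> [U [V [UU VV DE DQ]]]; exists (block_mx U 0 0 1%:M), V; split => //.
- by apply: unitary_block => //; exact: unitary1.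
- rewrite mul_block_col !mulmx0 mul0mx !addr0 mul_col_mx mul0mx.
  exact: diagonal_real_col.
rewrite mul_block_col !mulmx0 mul0mx !addr0 mul_col_mx mul0mx.
exact: diagonal_real_col.
Qed.

Lemma singular_pair_equiv m n (E : 'M[F]_(m, n)) a u v
    (U : 'M_m) (V : 'M_n) :
  unitary c U -> unitary c V -> singular_pair E a u v ->
  singular_pair (U *m E *m V^H) a (U *m u) (V *m v).
Proof.
move=> /unitary_adj UU /unitary_adj VV [Ev Eu]; split.
  by rewrite -mulmxA (mulmxA V^H) VV mul1mx -mulmxA Ev scalemxAr.
rewrite !adjM adjK -!mulmxA (mulmxA U^H) UU mul1mx Eu.
by rewrite scalemxAr.
Qed.

Lemma unit_cV_first n :
  (col_mx 1%:M 0 : 'cV[F]_(1 + n))^H *m col_mx 1%:M 0 = 1%:M.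
Proof. by rewrite adj_col adj1 adj0 mul_row_col mulmx1 mulmx0 addr0. Qed.

Lemma unit_cV_last n :
  (col_mx 0 1%:M : 'cV[F]_(n + 1))^H *m col_mx 0 1%:M = 1%:M.
Proof. by rewrite adj_col adj1 adj0 mul_row_col mulmx1 mulmx0 add0r. Qed.

(** The two equations of a singular pair fix the first column and the first row
    of E. *)
Lemma singular_pair_first m n (E : 'M[F]_(1 + m, 1 + n)) a :
  a \is Num.real -> singular_pair E a (col_mx 1%:M 0) (col_mx 1%:M 0) ->
  E = block_mx a%:M 0 0 (drsubmx E).
Proof.
move=> ar []; rewrite -{1 2}[E]submxK adj_block !mul_block_col.
rewrite !mulmx1 !mulmx0 !addr0 !scale_col_mx !scaler0 scalemx1.
move=> /eq_col_mx[ul dl] /eq_col_mx[_ ur].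
by rewrite -[LHS]submxK ul dl (adj_inj (etrans ur (esym (adj0 _ _)))).
Qed.

Lemma adj_kernel_last m n (E : 'M[F]_(m + 1, n)) :
  E^H *m col_mx 0 1%:M = 0 -> E = col_mx (usubmx E) 0.
Proof.
rewrite -{1}[E]vsubmxK adj_col mul_row_col mulmx0 mulmx1 add0r => dE.
by rewrite -[LHS]vsubmxK (adj_inj (etrans dE (esym (adj0 _ _)))).
Qed.

(** u and v may be divided by different scalars, because
    a |u|^2 = (E v)^* u = v^* E^* u = a |v|^2 forces equal norms unless
    a = 0. *)
Lemma singular_pair_normalize m n (E : 'M[F]_(m, n)) a u v s t :
  a \is Num.real -> 0 < s -> 0 < t ->
  u^H *m u = (s ^+ 2)%:M -> v^H *m v = (t ^+ 2)%:M ->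
  singular_pair E a u v -> singular_pair E a (s^-1 *: u) (t^-1 *: v).
Proof.
move=> ar s0 t0 us vt [Ev Eu].
have [a0|aN0] := eqVneq a 0.
  by split; rewrite -scalemxAr ?Ev ?Eu a0 !scale0r scaler0.
have st : s = t.
  have : (E *m v)^H *m u = v^H *m (E^H *m u) by rewrite adjM mulmxA.
  rewrite Ev Eu adjZ conj_real // -scalemxAl -scalemxAr us vt.
  move/(scalerI aN0)/matrixP/(_ 0 0); rewrite !mxE eqxx !mulr1n.
  by move/eqP; rewrite eqrXn2 ?ltW // => /eqP.
by subst t; split; rewrite -scalemxAr ?Ev ?Eu !scalerA mulrC.
Qed.

Hypothesis joint_eigenvector : forall n (A B : 'M[F]_n),
  (0 < n)%N -> A^H = A -> B^H = B -> A *m B = B *m A ->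
  exists x a b, [/\ x != 0 :> 'rV_n, a \is Num.real, b \is Num.real,
                    x *m A = a *: x & x *m B = b *: x].

(** A common eigenvector of the Hermitian dilations of E and Q. One of u and v
    may vanish, but not both. *)
Lemma joint_singular_pair m n (E Q : 'M[F]_(m, n)) :
  (0 < m + n)%N -> compatible E Q ->
  exists a b u v, [/\ a \is Num.real, b \is Num.real, (u != 0) || (v != 0),
    singular_pair E a u v & singular_pair Q b u v].
Proof.
move=> mn0 [EQ QE]; pose dilate X : 'M[F]_(m + n) := block_mx 0 X X^H 0.
have dilateH X : (dilate X)^H = dilate X by rewrite adj_block !adj0 adjK.
have dilateM X Y : dilate X *m dilate Y = block_mx (X *m Y^H) 0 0 (X^H *m Y).
  by rewrite mulmx_block !mulmx0 !mul0mx !addr0 !add0r.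
have [||||x [a [b [x0 ar br xE xQ]]]] :=
  joint_eigenvector (A := dilate E) (B := dilate Q).
- by [].
- exact: dilateH.
- exact: dilateH.
- by rewrite !dilateM EQ QE.
have pairP X e : e \is Num.real -> x *m dilate X = e *: x ->
    singular_pair X e (lsubmx x)^H (rsubmx x)^H.
  move=> er; rewrite -{1 2}[x]hsubmxK mul_row_block !mulmx0 add0r addr0.
  rewrite scale_row_mx => /eq_row_mx[rX lX].
  by split; apply: adj_inj; rewrite adjM adjZ !adjK conj_real.
exists a, b, (lsubmx x)^H, (rsubmx x)^H; split => //; try exact: pairP.
rewrite -negb_and; apply: contra x0 => /andP[/eqP l0 /eqP r0].
rewrite -[x]hsubmxK (adj_inj (etrans l0 (esym (adj0 _ _)))).
by rewrite (adj_inj (etrans r0 (esym (adj0 _ _)))) row_mx0.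
Qed.

(** The case v = 0 of the induction: the unit vector u / |u| is moved to the
    last position, where it produces a common zero row of E and Q. *)
Lemma simdiag_deflate_row m n (E Q : 'M[F]_(m, n)) (u : 'cV_m) :
  u != 0 -> E^H *m u = 0 -> Q^H *m u = 0 -> compatible E Q ->
  (forall m' (E' Q' : 'M[F]_(m', n)),
     m = m'.+1 -> compatible E' Q' -> simdiag E' Q') ->
  simdiag E Q.
Proof.
move=> u0 Eu Qu EQ IH.
have [m' em] := cV_neq0_size u0; rewrite -addn1 in em.
subst m; have [s [s0 _ u1]] := normalize_col u0.
have [U UU Ue] := unitary_transport u1 (unit_cV_last m').
have defl X : X^H *m u = 0 -> U *m X *m 1%:M = col_mx (usubmx (U *m X)) 0.
  move=> Xu; rewrite mulmx1; apply: adj_kernel_last.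
  rewrite -Ue adjM -mulmxA (mulmxA U^H) unitary_adj // mul1mx.
  by rewrite -scalemxAr Xu scaler0.
apply: (simdiag_equiv UU (unitary1 n)).
have := compatible_equiv UU (unitary1 n) EQ.
rewrite !defl // => /compatible_col EQ'.
by apply: simdiag_col; apply: IH EQ'; rewrite addn1.
Qed.

(** Induction on m + n rather than on one of the sizes: a joint singular pair
    with a vanishing vector removes only a row or only a column. *)
Theorem compatible_simdiag m n (E Q : 'M[F]_(m, n)) :
  compatible E Q -> simdiag E Q.
Proof.
have [k] := ubnP (m + n); elim: k => // k IH in m n E Q *.
rewrite ltnS => mnk EQ.
have [mn0|mn_gt0] := posnP (m + n).
  move/eqP: mn0; rewrite addn_eq0 => /andP[/eqP m0 _].
  subst m; have diag0 (D : 'M[F]_(0, n)) : diagonal_real D.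
    by split; [apply/is_diag_mxP|apply/mxOverP] => -[].
  by exists 1%:M, 1%:M; split; try exact: unitary1.
have [a [b [u [v [ar br uv Euv Quv]]]]] := joint_singular_pair mn_gt0 EQ.
have [u0|u0] := eqVneq u 0.
  rewrite u0 eqxx /= in uv; apply/simdiag_adj.
  apply: (simdiag_deflate_row uv).
  - by rewrite adjK Euv.1 u0 scaler0.
  - by rewrite adjK Quv.1 u0 scaler0.
  - exact: compatible_adj.
  - move=> n' E' Q' en; apply: IH; rewrite en addnS addnC in mnk; exact: mnk.
have [v0|v0] := eqVneq v 0.
  apply: (simdiag_deflate_row u0) => //.
  - by rewrite Euv.2 v0 scaler0.
  - by rewrite Quv.2 v0 scaler0.
  - move=> m' E' Q' em; apply: IH; rewrite em addSn in mnk; exact: mnk.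
have [m' em] := cV_neq0_size u0; have [n' en] := cV_neq0_size v0.
rewrite -add1n in em; rewrite -add1n in en.
subst m n; have [s [s0 us u1]] := normalize_col u0.
have [t [t0 vt v1]] := normalize_col v0.
have [U UU Ue] := unitary_transport u1 (unit_cV_first m').
have [V VV Ve] := unitary_transport v1 (unit_cV_first n').
have defl X e : e \is Num.real -> singular_pair X e u v ->
    U *m X *m V^H = block_mx e%:M 0 0 (drsubmx (U *m X *m V^H)).
  move=> er Xuv; apply: singular_pair_first => //; rewrite -{1}Ue -Ve.
  by apply: singular_pair_equiv => //; exact: singular_pair_normalize.
apply: (simdiag_equiv UU (unitaryH VV)).
have := compatible_equiv UU (unitaryH VV) EQ.
rewrite (defl E a) // (defl Q b) // => /compatible_block EQ'.
apply: simdiag_block => //; apply: IH EQ'.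
by apply: leq_trans mnk; rewrite addSn ltnS leq_add2l leqnSn.
Qed.

End Conjugation.

(** * Common eigenvectors of commuting Hermitian matrices *)

Lemma complex_joint_eigenvector (C : numClosedFieldType) n (A B : 'M[C]_n) :
  (0 < n)%N -> A ^t Num.conj = A -> B ^t Num.conj = B -> A *m B = B *m A ->
  exists x a b, [/\ x != 0 :> 'rV_n, a \is Num.real, b \is Num.real,
                    x *m A = a *: x & x *m B = b *: x].
Proof.
move=> n0 AH BH AB.
have [x x0 /andP[/sub_rVP[a xA] /sub_rVP[b xB]]] := common_eigenvector2 n0 AB.
have mul_conj (z : C) : z * z^* = `|z| ^+ 2 by rewrite normCK.
have eig_real D d : D ^t Num.conj = D -> x *m D = d *: x -> d \is Num.real.
  move=> DH xD; rewrite CrealE; apply/eqP.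
  exact: (hermitian_eigenvalue_conj conjCK mul_conj DH x0 xD).
by exists x, a, b; split => //; [exact: eig_real AH xA|exact: eig_real BH xB].
Qed.

(** Complexify: the complex eigenvalues are real, so that taking real parts
    preserves the eigenvector equations. Only a purely imaginary eigenvector has
    a vanishing real part, and multiplying it by i makes it real. *)
Lemma real_joint_eigenvector (R : rcfType) n (A B : 'M[R]_n) :
  (0 < n)%N -> A ^t idfun = A -> B ^t idfun = B -> A *m B = B *m A ->
  exists x a b, [/\ x != 0 :> 'rV_n, a \is Num.real, b \is Num.real,
                    x *m A = a *: x & x *m B = b *: x].
Proof.
move=> n0 AH BH AB; pose toC := real_complex R.
have herm_toC (D : 'M[R]_n) : D ^t idfun = D ->
    (map_mx toC D) ^t Num.conj = map_mx toC D.
  move=> DH; rewrite -{2}DH; apply/matrixP => i j; rewrite !mxE.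
  by rewrite conj_Creal // complex_real.
have [||||z [a [b [z0 ar br zA zB]]]] :=
  complex_joint_eigenvector (A := map_mx toC A) (B := map_mx toC B).
- by [].
- exact: herm_toC.
- exact: herm_toC.
- by rewrite -!map_mxM AB.
pose re (w : 'rV[R[i]]_n) := map_mx (@complex.Re R) w.
have re_eigen (D : 'M[R]_n) d w : d \is Num.real ->
    w *m map_mx toC D = d *: w -> re w *m D = complex.Re d *: re w.
  move=> dr wD; apply/rowP => j; rewrite !mxE.
  have := congr1 (fun M : 'rV_n => complex.Re (M 0 j)) wD.
  rewrite !mxE raddf_sum.
  rewrite -[in d * _](RRe_real dr) => wDj.
  transitivity (complex.Re ((complex.Re d)%:C%C * w 0 j)).
    rewrite -wDj; apply: eq_bigr => i _; rewrite !mxE.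
    by case: (w 0 i) => p q /=; rewrite mulr0 subr0.
  by case: (w 0 j) => p q /=; rewrite mul0r subr0.
have [w [w0 wA wB]] : exists w, [/\ re w != 0, w *m map_mx toC A = a *: w
                                 & w *m map_mx toC B = b *: w].
  have [re0|] := eqVneq (re z) 0; last by exists z.
  exists ('i%C *: z); split.
  - apply: contra_neq z0 => im0; apply/rowP => j; rewrite mxE.
    have := congr1 (fun M : 'rV_n => M 0 j) re0.
    have := congr1 (fun M : 'rV_n => M 0 j) im0; rewrite !mxE.
    case: (z 0 j) => p q /= /eqP; rewrite mul0r mul1r sub0r oppr_eq0.
    by move=> /eqP -> ->.
  - by rewrite -scalemxAl zA !scalerA mulrC.
  - by rewrite -scalemxAl zB !scalerA mulrC.
exists (re w), (complex.Re a), (complex.Re b).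
by split; rewrite ?num_real //; exact: re_eigen.
Qed.

(** * Sign correction *)

Definition row_signs (F : numFieldType) m (neg : pred 'I_m) : 'M[F]_m :=
  diag_mx (\row_i (-1) ^+ neg i).

Section SignCorrection.

Variables (F : numFieldType) (c : {rmorphism F -> F}) (m n : nat).
Implicit Types D : 'M[F]_(m, n).

Lemma unitary_row_signs (neg : pred 'I_m) : unitary c (row_signs F neg).
Proof.
rewrite /unitary tr_diag_mx map_diag_mx mulmx_diag -diag_const_mx.
congr diag_mx; apply/rowP => i; rewrite !mxE rmorph_sign.
by rewrite -expr2 sqrr_sign.
Qed.

Lemma row_signsE (neg : pred 'I_m) D i j :
  (row_signs F neg *m D) i j = (-1) ^+ neg i * D i j.
Proof. by rewrite mul_diag_mx !mxE. Qed.

Lemma diagonal_real_row_signs (neg : pred 'I_m) D :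
  diagonal_real D -> diagonal_real (row_signs F neg *m D).
Proof.
case=> /is_diag_mxP Dd /mxOverP Dr; split.
  by apply/is_diag_mxP => i j ij; rewrite row_signsE Dd ?mulr0.
by apply/mxOverP => i j; rewrite row_signsE rpredMsign.
Qed.

Lemma common_sign_ge0 (x y : F) : x \is Num.real -> 0 <= x * y ->
  0 <= (-1) ^+ ((x < 0) || (y < 0)) * x.
Proof.
move=> xr xy; case: (real_ltgt0P xr) => [x0|x0|->]; last by rewrite mulr0.
  rewrite pmulr_rge0 // in xy.
  by rewrite (le_gtF xy) mul1r ltW.
by rewrite mulN1r oppr_ge0 ltW.
Qed.

(** A row of a diagonal matrix has at most one nonzero entry, so asking whether
    it contains a negative entry detects the sign of the diagonal entry, and
    makes sense also in the rows that the diagonal does not meet. *)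
Lemma common_row_signs D1 D2 :
  diagonal_real D1 -> diagonal_real D2 ->
  (forall i j, 0 <= D1 i j * D2 i j) ->
  exists neg, row_signs F neg *m D1 \is a mxOver Num.nneg /\
              row_signs F neg *m D2 \is a mxOver Num.nneg.
Proof.
move=> [/is_diag_mxP D1d /mxOverP D1r] [/is_diag_mxP D2d /mxOverP D2r] D12.
pose neg i := [exists j, (D1 i j < 0) || (D2 i j < 0)].
have negE (i : 'I_m) (j : 'I_n) :
    i = j :> nat -> neg i = (D1 i j < 0) || (D2 i j < 0).
  move=> ij; apply/existsP/idP => [[j']|]; last by exists j.
  have [->|jj'] := eqVneq j' j; first by [].
  have ij' : i != j' :> nat by rewrite ij eq_sym.
  by rewrite D1d // D2d // ltxx.
exists neg; split; apply/mxOverP => i j; rewrite row_signsE nnegrE.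
  have [/negE->|/D1d->] := eqVneq (i : nat) (j : nat); last by rewrite mulr0.
  exact: common_sign_ge0.
have [/negE->|/D2d->] := eqVneq (i : nat) (j : nat); last by rewrite mulr0.
by rewrite orbC; apply: common_sign_ge0; rewrite 1?mulrC.
Qed.

End SignCorrection.

(** * The two fields of scalars *)

Lemma real_or_complex_simdiag (R : realType) (F : numFieldType) (c : F -> F) :
  real_or_complex R c -> exists2 c' : {rmorphism F -> F}, c = c' &
  [/\ involutive c', forall x, x * c' x = `|x| ^+ 2 &
    forall m n (E Q : 'M[F]_(m, n)), compatible c' E Q -> simdiag c' E Q].
Proof.
case: F c /.
  have real_mul_conj (x : R) : x * idfun x = `|x| ^+ 2.
    by rewrite real_normK ?num_real.
  exists (idfun : {rmorphism R -> R}) => //; split => // m n E Q.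
  apply: compatible_simdiag => //.
    by move=> x x0; exists (Num.sqrt x); rewrite ?sqrtr_ge0 ?sqr_sqrtr.
  exact: real_joint_eigenvector.
exists (Num.conj : {rmorphism R[i] -> R[i]}) => //; split.
- exact: conjCK.
- by move=> x; rewrite normCK.
- move=> m n E Q; apply: compatible_simdiag.
  + exact: conjCK.
  + by move=> x; rewrite normCK.
  + by move=> x x0; exists (sqrtC x); rewrite ?sqrtC_ge0 ?sqrtCK.
  + by move=> k; exact: complex_joint_eigenvector.
Qed.

(** With v the j-th column of V, the value v^* E^* Q v is the inner product of
    the j-th columns of UEV and UQV, which meet only on the diagonal. *)
Lemma possemidef_diag_mul_ge0 (F : numFieldType) (c : {rmorphism F -> F}) m n
    (E Q : 'M[F]_(m, n)) (U : 'M_m) (V : 'M_n) :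
  involutive c -> (forall x, x * c x = `|x| ^+ 2) -> unitary c U ->
  diagonal_real (U *m E *m V) -> possemidef c (E ^t c *m Q) ->
  forall i j, 0 <= (U *m E *m V) i j * (U *m Q *m V) i j.
Proof.
move=> cK mul_conj UU [/is_diag_mxP D1d /mxOverP D1r] [_ EQ] i j.
have [ij|/D1d->] := eqVneq (i : nat) (j : nat); last by rewrite mul0r.
have := EQ (col j V).
have -> : (col j V) ^t c *m (E ^t c *m Q) *m col j V
          = (col j (U *m E *m V)) ^t c *m col j (U *m Q *m V).
  rewrite !colE !adjM !mulmxA -(mulmxA _ (U ^t c) U).
  by rewrite unitary_adj // mulmx1.
move: (U *m E *m V) (U *m Q *m V) D1d D1r => D1 D2 D1d D1r.
rewrite mxE (bigD1 i) //= big1 => [|k ki]; rewrite !mxE.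
  by rewrite addr0 conj_real.
by rewrite D1d ?rmorph0 ?mul0r // -ij.
Qed.

Theorem proposition11 (R : realType) (F : numFieldType) (c : F -> F)
    (Fc : @real_or_complex R F c) (m n : nat) (E Q : 'M[F]_(m, n))
    (EQ_herm : E ^t c *m Q = Q ^t c *m E)
    (QE_herm : E *m Q ^t c = Q *m E ^t c) :
  [/\ exists (U : 'M[F]_m) (V : 'M[F]_n),
        [/\ unitary c U, unitary c V,
            diagonal_real (U *m E *m V) & diagonal_real (U *m Q *m V)],
      exists (U : 'M[F]_m) (V : 'M[F]_n),
        [/\ unitary c U, unitary c V,
            diagonal_real (U *m E *m V), diagonal_real (U *m Q *m V)
          & U *m E *m V \is a mxOver Num.nneg],
      exists (U : 'M[F]_m) (V : 'M[F]_n),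
        [/\ unitary c U, unitary c V,
            diagonal_real (U *m E *m V), diagonal_real (U *m Q *m V)
          & U *m Q *m V \is a mxOver Num.nneg]
    & possemidef c (E ^t c *m Q) ->
      exists (U : 'M[F]_m) (V : 'M[F]_n),
        [/\ unitary c U, unitary c V,
            diagonal_real (U *m E *m V), diagonal_real (U *m Q *m V)
          & U *m E *m V \is a mxOver Num.nneg
            /\ U *m Q *m V \is a mxOver Num.nneg]].
Proof.
have [c' cE [cK mul_conj simdiagP]] := real_or_complex_simdiag Fc.
move: EQ_herm QE_herm; rewrite {}cE => EQ QE {c Fc}.
have [U [V [UU VV DE DQ]]] := simdiagP _ _ _ _ (conj EQ QE).
have signed neg : exists (U' : 'M[F]_m) (V' : 'M[F]_n),
    [/\ unitary c' U', unitary c' V',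
        diagonal_real (U' *m E *m V'), diagonal_real (U' *m Q *m V')
      & U' *m E *m V' = row_signs F neg *m (U *m E *m V)
        /\ U' *m Q *m V' = row_signs F neg *m (U *m Q *m V)].
  exists (row_signs F neg *m U), V; rewrite -!mulmxA !(mulmxA U).
  split=> //; try exact: diagonal_real_row_signs.
  exact: unitaryM (unitary_row_signs c' neg) UU.
have sq_ge0 (D : 'M[F]_(m, n)) : diagonal_real D ->
    forall i j, 0 <= D i j * D i j.
  by case=> _ /mxOverP Dr i j; rewrite -expr2 -real_normK ?exprn_ge0.
split; first by exists U, V.
- have [neg [nE _]] := common_row_signs DE DE (sq_ge0 _ DE).
  have [U' [V' [UU' VV' DE' DQ' [EE' _]]]] := signed neg.
  by exists U', V'; split; rewrite // EE'.
- have [neg [nQ _]] := common_row_signs DQ DQ (sq_ge0 _ DQ).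
  have [U' [V' [UU' VV' DE' DQ' [_ QE']]]] := signed neg.
  by exists U', V'; split; rewrite // QE'.
move=> /(possemidef_diag_mul_ge0 cK mul_conj UU DE) EQ0.
have [neg [nE nQ]] := common_row_signs DE DQ EQ0.
have [U' [V' [UU' VV' DE' DQ' [EE' QE']]]] := signed neg.
by exists U', V'; split; rewrite // EE' QE'.
Qed.
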